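(* Let $t(n,k)$ be the number of paths in $\mathcal{M}'_1$ of length $n$ whose end-point has height $k$. The matrix $$[t(n+1,k+1)]_{n,k\ge0}=\left(\begin{array}{cccccc} 1 & 1 & 1 & 1 & 1 &\cdots \\ 3 & 3 & 3 & 3 & 3 &\cdots \\ 8 & 10 & 12 & 14 & 16 &\cdots \\ 23 & 33 & 43 & 53 & 63 &\cdots \\ 69 & 107 & 149 & 195 & 245 &\cdots \\ \vdots & \vdots & \vdots & \vdots & \vdots &\ddots \end{array}\right)$$ is the rectification of the Riordan array $(g(z),f(z))$ with $$f(z)=\frac{1-z^2-\sqrt{1-4z+2z^2-4z^3+z^4}}{2}$$ and $$g(z)=\frac{1-3z+z^2-z^3-(1-z)\sqrt{1-4z+2z^2-4z^3+z^4}}{2z^3(1-z+z^2)}.$$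
   Context: $\mathcal{M}'_1$ is the set of lattice paths in $\mathbb{N}^2$ (with $\mathbb{N}=\{0,1,2,\dots\}$, so paths never go below the $x$-axis) starting at the origin, made of up steps $(1,k)$ with $k\ge 1$, down steps $(1,-1)$ and horizontal steps $(1,0)$, in which two up steps are never consecutive. The empty path belongs to $\mathcal{M}'_1$. The length of a path is its number of steps; the height of a point is its ordinate. The square root is the power series with constant term $1$. For formal power series $g,f$ with $g(0)\ne0$, $f(0)=0$, $f'(0)\neq0$, the Riordan array $(g(z),f(z))$ is the infinite lower triangular matrix whose $k$-th column ($k\ge0$) has generating function $g(z)f(z)^k$. A matrix $[m_{n,k}]_{n,k\ge0}$ is the rectification of the Riordan array $(g(z),f(z))$ if its bivariate generating function $\sum_{n,k\ge0} m_{n,k}z^nu^k$ equals $\frac{g(z)}{1-u\frac{f(z)}{z}}$. *)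

(* Defs.v *)
From HB Require Import structures.
From mathcomp Require Import all_boot all_order all_algebra.
From mathcomp Require Import finmap boolp classical_sets cardinality.
From mathcomp Require Import ring lra zify.

Set Implicit Arguments.
Unset Strict Implicit.
Unset Printing Implicit Defensive.
Import Order.TTheory GRing.Theory Num.Theory.
Local Open Scope ring_scope.

(******************************************************************************)
(*   {fps R} == formal power series over R; a n is the coefficient of degree  *)
(*              n of a : {fps R}. {fps R} inherits the commutative ring, unit *)
(*              ring and integral domain structures of R; a is a unit iff     *)
(*              a 0 is, so that, e.g., / 2 makes sense in {fps rat}.          *)
(*   fpsC c  == the constant power series c                                   *)
(*   fpsX    == the variable                                                  *)
(*   fps_divX a == a / X, for a with a 0 = 0                                  *)
(*   fps_sqrt a == the square root of a with constant term 1, for a 0 = 1     *)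
(******************************************************************************)

Record fps (R : Type) := Fps { fps_coef :> nat -> R }.

Notation "{ 'fps' R }" := (fps R) (format "{ 'fps'  R }") : type_scope.

HB.instance Definition _ (R : Type) := gen_eqMixin {fps R}.
HB.instance Definition _ (R : Type) := gen_choiceMixin {fps R}.

Lemma fpsP (R : Type) (a b : {fps R}) : (forall n, a n = b n) <-> a = b.
Proof.
split=> [|->//]; case: a b => [a] [b] /= ab.
by congr Fps; apply/funext.
Qed.

Section FpsRing.
Variable R : comNzRingType.
Implicit Types a b c : {fps R}.

Definition fps_add a b : {fps R} := Fps (fun n => a n + b n).
Definition fps_opp a : {fps R} := Fps (fun n => - a n).
Definition fps_zero : {fps R} := Fps (fun=> 0).

Lemma fps_addA : associative fps_add.
Proof. by move=> a b c; apply/fpsP => n /=; rewrite addrA. Qed.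
Lemma fps_addC : commutative fps_add.
Proof. by move=> a b; apply/fpsP => n /=; rewrite addrC. Qed.
Lemma fps_add0 : left_id fps_zero fps_add.
Proof. by move=> a; apply/fpsP => n /=; rewrite add0r. Qed.
Lemma fps_addN : left_inverse fps_zero fps_opp fps_add.
Proof. by move=> a; apply/fpsP => n /=; rewrite addNr. Qed.

HB.instance Definition _ :=
  GRing.isZmodule.Build {fps R} fps_addA fps_addC fps_add0 fps_addN.

Definition fpsC (c : R) : {fps R} := Fps (fun n => if n == 0%N then c else 0).
Definition fpsX : {fps R} := Fps (fun n => (n == 1%N)%:R).
Definition fps_mul a b : {fps R} :=
  Fps (fun n => \sum_(i < n.+1) a i * b (n - i)%N).

Definition fps_trunc n a : {poly R} := \poly_(i < n.+1) a i.

Lemma coef_fps_trunc n a i : (i <= n)%N -> (fps_trunc n a)`_i = a i.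
Proof. by move=> le_in; rewrite coef_poly ltnS le_in. Qed.

Lemma fps_mul_trunc n a b i : (i <= n)%N ->
  fps_mul a b i = (fps_trunc n a * fps_trunc n b)`_i.
Proof.
move=> le_in; rewrite coefM; apply: eq_bigr => j _.
have le_jn : (j <= n)%N by apply: leq_trans le_in; rewrite -ltnS.
by rewrite !coef_fps_trunc // (leq_trans (leq_subr _ _)).
Qed.

Lemma fps_mulC : commutative fps_mul.
Proof.
by move=> a b; apply/fpsP => n; rewrite !(fps_mul_trunc _ _ (leqnn n)) mulrC.
Qed.

Lemma fps_mulA : associative fps_mul.
Proof.
move=> a b c; apply/fpsP => n.
transitivity (fps_trunc n a * (fps_trunc n b * fps_trunc n c))`_n.
  rewrite coefM; apply: eq_bigr => i _.
  have le_in : (i <= n)%N by rewrite -ltnS.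
  by rewrite coef_fps_trunc // (fps_mul_trunc _ _ (leq_subr i n)).
rewrite mulrA coefM; apply: eq_bigr => i _.
have le_in : (i <= n)%N by rewrite -ltnS.
by rewrite (fps_mul_trunc _ _ le_in) coef_fps_trunc ?leq_subr.
Qed.

Lemma fps_mul1 : left_id (fpsC 1) fps_mul.
Proof.
move=> a; apply/fpsP => n /=; rewrite big_ord_recl /= mul1r subn0.
by rewrite big1 ?addr0 // => i _; rewrite mul0r.
Qed.

Lemma fps_mulDl : left_distributive fps_mul fps_add.
Proof.
move=> a b c; apply/fpsP => n /=; rewrite -big_split /=.
by apply: eq_bigr => i _; rewrite mulrDl.
Qed.

Lemma fps_one_neq0 : fpsC 1 != 0.
Proof.
by apply/eqP => /fpsP/(_ 0%N) /= /eqP; rewrite oner_eq0.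
Qed.

HB.instance Definition _ := GRing.Zmodule_isComNzRing.Build {fps R}
  fps_mulA fps_mulC fps_mul1 fps_mulDl fps_one_neq0.

Lemma fps0E n : (0 : {fps R}) n = 0. Proof. by []. Qed.
Lemma fps1E n : (1 : {fps R}) n = (n == 0%N)%:R. Proof. by case: n. Qed.
Lemma fpsCE (c : R) n : fpsC c n = if n == 0%N then c else 0. Proof. by []. Qed.
Lemma fpsXE n : fpsX n = (n == 1%N)%:R. Proof. by []. Qed.
Lemma fpsDE a b n : (a + b) n = a n + b n. Proof. by []. Qed.
Lemma fpsNE a n : (- a) n = - a n. Proof. by []. Qed.
Lemma fpsME a b n : (a * b) n = \sum_(i < n.+1) a i * b (n - i)%N.
Proof. by []. Qed.

Lemma fpsM0E a b : (a * b) 0%N = a 0%N * b 0%N.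
Proof. by rewrite fpsME big_ord1. Qed.

Lemma fps_natrE m n : (m%:R : {fps R}) n = if n == 0%N then m%:R else 0.
Proof.
elim: m => [|m IHm]; first by rewrite mulr0n; case: ifP.
by rewrite -addn1 !natrD fpsDE IHm fps1E; case: eqP; rewrite ?addr0.
Qed.

Lemma fpsCM (c : R) a n : (fpsC c * a) n = c * a n.
Proof.
rewrite fpsME big_ord_recl /= subn0 big1 ?addr0 // => i _.
by rewrite mul0r.
Qed.

Lemma fpsXM a n : (fpsX * a) n = if n is n'.+1 then a n' else 0.
Proof.
rewrite fpsME big_ord_recl /= mul0r add0r; case: n => [|n].
  by rewrite big_ord0.
rewrite big_ord_recl /= mul1r subSS subn0 big1 ?addr0 // => i _.
by rewrite mul0r.
Qed.

Definition fps_divX a : {fps R} := Fps (fun n => a n.+1).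

Lemma fps_divXK a : a 0%N = 0 -> fpsX * fps_divX a = a.
Proof. by move=> a0; apply/fpsP => -[|n]; rewrite fpsXM. Qed.

End FpsRing.

Arguments fpsX {R}.

(* The series whose coefficient of degree n is F applied to the sequence      *)
(* of its first n coefficients.                                               *)
Section FpsRec.
Variables (R : nzRingType) (F : seq R -> R).

Definition fps_rec_prefix n := iter n (fun s => rcons s (F s)) [::].
Definition fps_rec : {fps R} := Fps (fun n => F (fps_rec_prefix n)).

Lemma fps_recE n : fps_rec n = F (mkseq fps_rec n).
Proof.
suff -> : mkseq fps_rec n = fps_rec_prefix n by [].
elim: n => //= n IHn.
by rewrite /mkseq -addn1 iotaD map_cat /= cats1 -/(mkseq _ n) IHn.
Qed.

End FpsRec.

Section FpsUnit.
Variable R : comUnitRingType.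
Implicit Types a b : {fps R}.

Definition fps_unit : pred {fps R} := fun a => a 0%N \is a GRing.unit.

Definition fps_inv a : {fps R} :=
  if a 0%N \is a GRing.unit then
    fps_rec (fun s => (a 0%N)^-1 *
      ((size s == 0%N)%:R - \sum_(i < size s) a (size s - i)%N * s`_i))
  else a.

Lemma fps_mulV : {in fps_unit, left_inverse 1 fps_inv *%R}.
Proof.
move=> a ua; have ua0 : a 0%N \is a GRing.unit by [].
apply/fpsP => n; rewrite fps1E fpsME big_ord_recr /= subnn.
rewrite /fps_inv ua0; set b := fps_rec _.
rewrite {2}/b fps_recE size_mkseq -/b mulrAC mulVr // mul1r.
rewrite addrCA [X in _ + X](_ : _ = 0) ?addr0 //; apply/eqP.
rewrite subr_eq0; apply/eqP/eq_bigr => i _.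
by rewrite nth_mkseq // mulrC.
Qed.

Lemma fps_unitP a b : b * a = 1 -> fps_unit a.
Proof.
move=> /fpsP/(_ 0%N); rewrite fpsM0E fps1E /fps_unit => ba1.
by apply/unitrPr; exists (b 0%N); rewrite mulrC.
Qed.

Lemma fps_inv_out : {in [predC fps_unit], fps_inv =1 id}.
Proof.
by move=> a /negP na; rewrite /fps_inv ifF //; apply/negP.
Qed.

HB.instance Definition _ := GRing.ComNzRing_hasMulInverse.Build {fps R}
  fps_mulV fps_unitP fps_inv_out.

Lemma fps_unitE a : (a \is a GRing.unit) = (a 0%N \is a GRing.unit).
Proof. by []. Qed.

End FpsUnit.

Section FpsDomain.
Variable R : idomainType.
Implicit Types a b : {fps R}.

Lemma fps_mulf_eq0 a b : a * b = 0 -> (a == 0) || (b == 0).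
Proof.
move=> ab0; apply/orP; case: (eqVneq a 0) => [|na]; [by left | right].
have [m am min_m] : exists2 m, a m != 0 & forall i, (i < m)%N -> a i = 0.
  have ex_a : exists m, a m != 0.
    apply: contrapT => nex; case/eqP: na; apply/fpsP => n.
    by apply/eqP/negP => /negP an; apply: nex; exists n.
  exists (ex_minn ex_a); case: ex_minnP => // m _ min_m i lt_im.
  by apply/eqP/negP => /negP /min_m; rewrite leqNgt lt_im.
apply/eqP/fpsP => n; elim/ltn_ind: n => n IHn.
have /fpsP/(_ (m + n)%N) := ab0; rewrite fpsME fps0E.
have lt_m : (m < (m + n).+1)%N by rewrite ltnS leq_addr.
rewrite (bigD1 (Ordinal lt_m)) //= addKn big1 ?addr0 => [/eqP|[i lt_i]].
  by rewrite mulf_eq0 (negPf am) => /eqP.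
rewrite -val_eqE /= => ne_im; have [lt_im|le_mi] := ltnP i m.
  by rewrite min_m ?mul0r.
by rewrite IHn ?mulr0 //; move: ne_im le_mi lt_i; lia.
Qed.

HB.instance Definition _ :=
  GRing.ComUnitRing_isIntegral.Build {fps R} fps_mulf_eq0.

End FpsDomain.

Notation "x %:F" := (tofrac x) : ring_scope.

Section FpsSqrt.
Variable R : idomainType.
Implicit Types a b : {fps R}.

Definition fps_sqrt a : {fps R} :=
  fps_rec (fun s => if size s is n.+1
    then (a n.+1 - \sum_(i < n) s`_i.+1 * s`_(n - i)%N) / 2 else 1).

Lemma fps_sqrt0 a : fps_sqrt a 0%N = 1.
Proof. by []. Qed.

Lemma sqr_fps_sqrt a : (2 : R) \is a GRing.unit -> a 0%N = 1 ->
  fps_sqrt a ^+ 2 = a.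
Proof.
move=> u2 a0; rewrite expr2; apply/fpsP => -[|n].
  by rewrite fpsM0E fps_sqrt0 a0 mulr1.
have E : fps_sqrt a n.+1 =
    (a n.+1 - \sum_(i < n) fps_sqrt a i.+1 * fps_sqrt a (n - i)%N) / 2.
  rewrite {1}/fps_sqrt fps_recE -/(fps_sqrt a) size_mkseq.
  congr ((_ - _) / _); apply: eq_bigr => i _.
  by rewrite !nth_mkseq // ltnS ?ltn_ord ?leq_subr.
move: (fps_sqrt a) E (fps_sqrt0 a) => s E s0.
rewrite fpsME big_ord_recl big_ord_recr /= subn0 subnn s0 mul1r mulr1.
rewrite /bump /=; under eq_bigr do rewrite add1n subSS.
by rewrite add1n addrCA -mulr2n -mulr_natr E divrK // addrC subrK.
Qed.

Lemma fps_sqrt_uniq a b : (2 : R) \is a GRing.unit ->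
  b 0%N = 1 -> b ^+ 2 = a -> b = fps_sqrt a.
Proof.
move=> u2 b0 ba; have a0 : a 0%N = 1 by rewrite -ba expr2 fpsM0E b0 mulr1.
have /eqP := sqr_fps_sqrt u2 a0; rewrite -{2}ba eq_sym eqf_sqr.
case/orP=> /eqP // bE; move/fpsP/(_ 0%N): bE.
rewrite fpsNE fps_sqrt0 b0 => /eqP; rewrite -addr_eq0 => /eqP e.
by move: u2; rewrite -[2]/(1 + 1) e unitr0.
Qed.

End FpsSqrt.

Section Riordan.
Variable R : fieldType.
Implicit Types (f g : {fps R}) (m : nat -> nat -> R).

Definition riordan_pair g f := [/\ g 0%N != 0, f 0%N = 0 & f 1%N != 0].

Definition riordan_array g f : nat -> nat -> R := fun n k => (g * f ^+ k) n.

(* Bivariate series in z and u are elements of R[[z]][[u]], in which          *)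
(* 1 - u f(z)/z is a unit.                                                    *)
Definition bivariate_gf m : {fps {fps R}} := Fps (fun k => Fps (fun n => m n k)).

Definition is_rectification m g f :=
  riordan_pair g f /\
  bivariate_gf m = fpsC g / (1 - fpsX * fpsC (fps_divX f)).

Lemma rectification_unit f :
  (1 - fpsX * fpsC (fps_divX f) : {fps {fps R}}) \is a GRing.unit.
Proof. by rewrite fps_unitE fpsDE fpsNE fpsXM oppr0 addr0 unitr1. Qed.

Lemma is_rectificationE m g f n k : is_rectification m g f ->
  m n k = riordan_array g f (n + k)%N k.
Proof.
case=> -[_ f0 _]; set h := fps_divX f => gfE.
have {}gfE : bivariate_gf m = fpsC g + fpsX * (fpsC h * bivariate_gf m).
  apply/eqP; rewrite -subr_eq mulrA -{1}[bivariate_gf m]mul1r -mulrBl gfE.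
  by rewrite mulrCA divrr ?mulr1 // rectification_unit.
have colE j : bivariate_gf m j = g * h ^+ j.
  elim: j => [|j IHj]; rewrite gfE fpsDE fpsXM fpsCE ?addr0 ?mulr1 //.
  by rewrite add0r fpsCM IHj exprS mulrCA.
transitivity (bivariate_gf m k n) => //; rewrite colE /riordan_array.
rewrite -(fps_divXK f0) -/h exprMn mulrCA.
move: (g * h ^+ k) => e; elim: k => [|k IHk]; first by rewrite addn0 mul1r.
by rewrite exprS -mulrA addnS fpsXM.
Qed.

End Riordan.

(* A step (1, d) of a lattice path is represented by d, a path starting at    *)
(* the origin by the sequence of its steps.                                   *)
Definition is_up (d : int) := 1 <= d.
Definition is_step (d : int) := [|| is_up d, d == -1 | d == 0].
Definition end_height (p : seq int) : int := \sum_(d <- p) d.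

Definition M1' : set (seq int) := [set p : seq int | [/\ all is_step p,
  forall i, 0 <= end_height (take i p)
  & sorted (fun d e => ~~ (is_up d && is_up e)) p]]%classic.

(* fset_set A is the finite set with the elements of A when A is finite,      *)
(* which is the case here by M1'_finite.                                      *)
Definition num_paths (n k : nat) : nat := #|` fset_set [set p : seq int | [/\ M1' p,
  size p = n & end_height p = k]]%classic|.

Lemma M1'_finite n k :
  finite_set [set p : seq int | [/\ M1' p, size p = n & end_height p = Posz k]]%classic.
Proof.
set N := (n + k).+2.
pose s : seq (seq int) :=
  [seq [seq Posz (nat_of_ord i) - 1 | i <- val u] | u <- enum {: n.-tuple 'I_N}].
apply: (@sub_finite_set _ _ [set` s]%classic); last exact: finite_seq.
suff sP (p : seq int) : all is_step p -> size p = n -> end_height p = k -> p \in s.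
  by move=> p /= [[steps _ _]]; apply: sP.
move=> steps sz_p hp.
have ge_step d : is_step d -> -1 <= d.
  by case/or3P=> [|/eqP->|/eqP->] //; apply: le_trans.
have heightE d (q : seq int) : end_height (d :: q) = d + end_height q.
  by rewrite /end_height big_cons.
have lb (q : seq int) : all is_step q -> - (size q)%:Z <= end_height q.
  elim: q => [|d q IHq] /=; first by rewrite /end_height big_nil.
  by case/andP=> /ge_step sd /IHq; rewrite heightE; lia.
have bnd d : d \in p -> -1 <= d < N%:Z - 1.
  move=> /path.splitPr pd; case: pd steps sz_p hp => p1 p2.
  rewrite all_cat size_cat /= => /and3P[/lb l1 /ge_step sd /lb l2] sz.
  rewrite [end_height _]big_cat /= -/(end_height _) -/(end_height _) heightE.
  by rewrite /N; lia.
apply/mapP; have sz_u : size [seq inord (absz (d + 1)) : 'I_N | d <- p] == n.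
  by rewrite size_map sz_p.
exists (Tuple sz_u); first by rewrite mem_enum.
rewrite /= -map_comp -[LHS]map_id; apply/eq_in_map => d /bnd /=.
by rewrite /N => bd; rewrite inordK; lia.
Qed.

(* Main.v *)
Require Import Defs.
From mathcomp Require Import all_boot all_order all_algebra.
From mathcomp Require Import finmap classical_sets cardinality.
From mathcomp Require Import ring lra zify.
Set Implicit Arguments.
Unset Strict Implicit.
Unset Printing Implicit Defensive.
Import GRing.Theory.
Local Open Scope ring_scope.

(** Cut a path just before its last step. Let T_k(z) count the paths ending at
    height k by length, and V_k(z) those of them whose last step is not an up
    step. A path of the second kind is empty or ends with a horizontal or a down
    step, which may follow anything; an up step may only follow a path of the
    second kind. Hence
      V_k = [k = 0] + z (T_k + T_(k+1)),
      T_k = V_k + z (V_0 + ... + V_(k-1)),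
    and this system determines all the coefficients by induction on the length
    (path_gf_unique; the recurrences on numbers are size_pathsS and num_flatS,
    obtained from a duplicate-free enumeration of the paths).

    It remains to exhibit a solution in which the T_(k+1) are geometric in k.
    Put f = z h and try T_(k+1) = z g h^k. For k >= 1, taking differences in k
    in the second equation, it reduces to
      (f - z) (1 - z - f) = z^2 (z + f),
    that is, f^2 - (1 - z^2) f + z - z^2 + z^3 = 0, which is the quadratic
    equation whose root vanishing at 0 is the f of the theorem. The equations
    for k = 0 and the first difference then force T_0 = g (1 - z - f) and
      g (1 - 2 z - (1 - z) f) = 1.
    So g is the inverse of a series with constant term 1
    (path_gf_geometric); its announced closed form follows from the quadratic
    equation, and geometric columns are exactly what a rectification is
    (rectificationP). *)

(** * Appending a step to a path *)

(** The default value 0, a horizontal step, makes the empty path count as not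
    ending with an up step, so that any step may follow it. *)
Definition ends_up (p : seq int) := is_up (last 0 p).

Lemma is_stepE d : is_step d = (-1 <= d).
Proof. by rewrite /is_step /is_up; lia. Qed.

Lemma end_height_rcons p d : end_height (rcons p d) = end_height p + d.
Proof. by rewrite /end_height big_rcons. Qed.

Lemma M1'_nil : M1' [::].
Proof. by split=> // i; rewrite /end_height big_nil. Qed.

Lemma M1'_ge0 p : M1' p -> 0 <= end_height p.
Proof. by case=> _ /(_ (size p)); rewrite take_size. Qed.

Lemma M1'_rcons p d : M1' (rcons p d) <->
  [/\ M1' p, -1 <= d, 0 <= end_height p + d
    & ~~ (ends_up p && is_up d)].
Proof.
rewrite /M1' /= all_rcons is_stepE -end_height_rcons.
have -> : sorted (fun d e => ~~ (is_up d && is_up e)) (rcons p d) =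
    sorted (fun d e => ~~ (is_up d && is_up e)) p
      && ~~ (ends_up p && is_up d).
  by case: p => [|x p] //=; rewrite /ends_up rcons_path.
split=> [[/andP[sd sp] hp /andP[srt nup]]|[[sp hp srt] sd hpd nup]].
  split=> //; last by move: (hp (size (rcons p d))); rewrite take_size.
  split=> // i; have [le_ip|/ltnW lt_pi] := leqP i (size p).
    by move: (hp i); rewrite -cats1 takel_cat.
  by move: (hp (size p)); rewrite -cats1 take_size_cat // take_oversize.
split; rewrite ?sd ?srt // => i; have [le_ip|lt_pi] := leqP i (size p).
  by rewrite -cats1 takel_cat.
by rewrite take_oversize // size_rcons.
Qed.

(** * Enumeration of the paths *)

(** A path ending at height k comes from a path ending at some height j <= k + 1
    by a step k - j, which is up, horizontal or down according to whether j < k,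
    j = k or j = k + 1; treating the three kinds of steps uniformly makes the
    last step determine j, hence the absence of repetitions. *)
Fixpoint paths (n k : nat) : seq (seq int) :=
  if n is n'.+1 then
    [seq rcons p (k%:Z - j%:Z) | j <- iota 0 k.+2,
       p <- [seq p <- paths n' j | ~~ (ends_up p && is_up (k%:Z - j%:Z))]]
  else if k == 0%N then [:: [::]] else [::].

Lemma mem_paths n k p :
  reflect [/\ M1' p, size p = n & end_height p = k%:Z] (p \in paths n k).
Proof.
apply: (iffP idP).
  elim: n k p => [|n IHn] k p.
    case: k => // /[!inE] /eqP ->; split=> //; first exact: M1'_nil.
    by rewrite /end_height big_nil.
  case/(@allpairsPdep _ (fun=> seq int)) => j [q [+ + ->]].
  rewrite mem_iota mem_filter add0n.
  move=> /= lt_jk /andP[nup /IHn[Mq sz_q hq]].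
  rewrite size_rcons sz_q end_height_rcons hq; split=> //; last lia.
  by rewrite M1'_rcons hq; split=> //; lia.
elim: n k p => [|n IHn] k p [Mp sz_p hp].
  move/size0nil: sz_p hp => ->; rewrite /end_height big_nil.
  by case: k.
case/lastP: p => [|p d] // in Mp sz_p hp *.
move: Mp sz_p hp; rewrite M1'_rcons size_rcons end_height_rcons.
case=> Mp sd _ nup [sz_p] hp; have h0 := M1'_ge0 Mp.
pose j := `|end_height p|%N; have jE : end_height p = j%:Z by lia.
have dE : d = k%:Z - j%:Z by lia.
apply/(@allpairsPdep _ (fun=> seq int)); exists j, p; split.
- by rewrite mem_iota; lia.
- by rewrite mem_filter -dE nup IHn.
- by rewrite dE.
Qed.

Lemma paths_uniq n k : uniq (paths n k).
Proof.
elim: n k => [|n IHn] k; first by case: k.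
apply: (@allpairs_uniq_dep _ (fun=> seq int)); first exact: iota_uniq.
  by move=> j _; rewrite filter_uniq.
by move=> [i p] [j q] _ _ /= /rcons_inj[-> eq_ij]; congr (existT _ _ _); lia.
Qed.

Lemma num_pathsE n k : num_paths n k = size (paths n k).
Proof.
rewrite /num_paths; apply/perm_size/uniq_perm.
- exact: fset_uniq.
- exact: paths_uniq.
move=> p; rewrite in_fset_set; last exact: M1'_finite.
by apply/idP/mem_paths; rewrite inE.
Qed.

(** * The recurrences *)

Definition num_flat n k := count (fun p => ~~ ends_up p) (paths n k).

Lemma size_paths0 k : size (paths 0 k) = (k == 0%N).
Proof. by case: k. Qed.

Lemma num_flat0 k : num_flat 0 k = (k == 0%N).
Proof. by case: k. Qed.

(** Sorts the paths by their last step: an up step comes from a height j < k and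
    cannot follow an up step; the other two steps are unrestricted. The counting
    predicate is arbitrary so as to give both recurrences below. *)
Lemma count_pathsS (a : pred (seq int)) n k :
  count a (paths n.+1 k) =
  (\sum_(j < k) count (fun p => a (rcons p (k%:Z - j%:Z)%R))
                      [seq p <- paths n j | ~~ ends_up p]
   + count (fun p => a (rcons p 0%R)) (paths n k)
   + count (fun p => a (rcons p (-1)%R)) (paths n k.+1))%N.
Proof.
pose late j := [seq p <- paths n j | ~~ (ends_up p && is_up (k%:Z - j%:Z))].
have -> : paths n.+1 k = flatten
    [seq [seq rcons p (k%:Z - j%:Z) | p <- late j] | j <- iota 0 k.+2] by [].
rewrite count_flatten -map_comp sumnE big_map.
rewrite -[iota 0 k.+2]/(index_iota 0 k.+2) big_mkord !big_ord_recr /=.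
have up_d j : is_up (k%:Z - j%:Z) = (j < k)%N by rewrite /is_up; lia.
congr (_ + _ + _)%N.
- apply: eq_bigr => j _; rewrite /= count_map /late up_d ltn_ord.
  by congr count; apply: eq_filter => p; rewrite andbT.
- rewrite /= count_map /late up_d ltnn subrr.
  by rewrite (@eq_filter _ _ predT) ?filter_predT // => p; rewrite andbF.
- rewrite /= count_map /late up_d ltnNge leqnSn.
  have -> : k%:Z - k.+1%:Z = -1 by lia.
  by rewrite (@eq_filter _ _ predT) ?filter_predT // => p; rewrite andbF.
Qed.

Lemma size_pathsS n k :
  size (paths n.+1 k) = (\sum_(j < k) num_flat n j
    + size (paths n k) + size (paths n k.+1))%N.
Proof.
rewrite -count_predT count_pathsS !count_predT.
by under eq_bigr do rewrite count_predT size_filter.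
Qed.

Lemma num_flatS n k :
  num_flat n.+1 k = (size (paths n k) + size (paths n k.+1))%N.
Proof.
rewrite /num_flat count_pathsS big1 => [|j _].
  rewrite add0n; congr (_ + _)%N; rewrite -[RHS]count_predT.
    by apply: eq_count => p; rewrite /ends_up last_rcons.
  by apply: eq_count => p; rewrite /ends_up last_rcons.
apply/eqP; rewrite -leqn0 leqNgt -has_count; apply/negP => /hasP[p _].
by rewrite /ends_up last_rcons /is_up; have := ltn_ord j; lia.
Qed.

(** * Generating functions *)

(** Each equation has a factor z in front of the unknowns of its sum, so that
    the coefficients of degree n + 1 depend on those of degree n only; T_k also
    involves V_k at the same degree, which is therefore computed first. *)
Lemma path_gf_unique (R : comNzRingType) (T V : nat -> {fps R}) :
  (forall k, V k = (k == 0%N)%:R + fpsX * (T k + T k.+1)) ->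
  (forall k, T k = V k + fpsX * \sum_(j < k) V j) ->
  forall n k, T k n = (size (paths n k))%:R.
Proof.
move=> VE TE n k.
suff [] : T k n = (size (paths n k))%:R /\ V k n = (num_flat n k)%:R by [].
elim: n k => [|n IHn] k.
  have V0 : V k 0%N = (num_flat 0 k)%:R.
    rewrite VE fpsDE fpsXM addr0 num_flat0; case: k => [|k] //.
  by split; rewrite // TE fpsDE fpsXM addr0 V0 num_flat0 size_paths0.
have VS : V k n.+1 = (num_flat n.+1 k)%:R.
  rewrite VE fpsDE fpsXM fpsDE !(proj1 (IHn _)) num_flatS natrD.
  by rewrite fps_natrE add0r.
split=> //; rewrite TE fpsDE fpsXM VS num_flatS size_pathsS.
rewrite -addnA [RHS]natrD [LHS]addrC.
congr (_ + _); rewrite natr_sum.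
elim/big_ind2: _ => // [|i _]; last by case: (IHn i).
by move=> a x b y; rewrite fpsDE => -> ->.
Qed.

(** The hypotheses say that f = z h satisfies its quadratic equation, divided by
    z, and that g is the inverse of 1 - 2 z - (1 - z) f: these are the conditions
    for the geometric sequence T_(k+1) = z g h^k to solve the system. *)
Lemma path_gf_geometric (R : comNzRingType) (g h : {fps R}) :
  fpsX * h ^+ 2 = (1 - fpsX ^+ 2) * h - (1 - fpsX + fpsX ^+ 2) ->
  g * (1 - 2 * fpsX - (1 - fpsX) * (fpsX * h)) = 1 ->
  forall n k, (size (paths n.+1 k.+1))%:R = (g * h ^+ k) n.
Proof.
set z := fpsX => hE gE n k.
pose T k := if k is k'.+1 then z * g * h ^+ k' else g * (1 - z - z * h).
pose V k := if k is k'.+1 then z ^+ 2 * g * h ^+ k' * (1 + h)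
            else g * (1 - z - z * h).
rewrite -(@path_gf_unique _ T V) => [|{}k|{n}{}k].
- by rewrite /T -mulrA fpsXM.
- rewrite -/z; case: k => [|k]; rewrite /T /V.
    by rewrite -[1%:R]gE; ring.
  by rewrite mulr0n add0r [h ^+ k.+1]exprS; ring.
rewrite -/z; elim: k => [|k IHk]; first by rewrite big_ord0 mulr0 addr0.
(* The induction hypothesis turns the first k terms of the sum into T k - V k. *)
have -> : \sum_(j < k.+1) V j = \sum_(j < k) V j + V k by rewrite big_ord_recr.
rewrite mulrDr -[z * \sum_(j < k) V j](addKr (V k)) -IHk.
case: k {IHk} => [|k]; rewrite /T /V; first by ring.
(* Divided by z g h^k, this is (f - z) (1 - z - f) = z^2 (z + f) divided by z. *)
by rewrite [h ^+ k.+1]exprS; ring: hE.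
Qed.

(** The bivariate series g / (1 - u h) is the one whose coefficient of u^k is
    g h^k; with f = z h, h is f / z. *)
Lemma rectificationP (R : fieldType) (m : nat -> nat -> R) (g h : {fps R}) :
  g 0%N != 0 -> h 0%N != 0 ->
  (forall n k, m n k = (g * h ^+ k) n) -> is_rectification m g (fpsX * h).
Proof.
move=> g0 h0 mE; split; first by split; rewrite ?fpsXM.
have -> : fps_divX (fpsX * h) = h.
  by apply/fpsP => n; rewrite -[LHS]/((fpsX * h) n.+1) fpsXM.
apply: (canRL (mulrK _)); last apply/fpsP => k.
  by rewrite fps_unitE fpsDE fpsNE fpsXM oppr0 addr0 unitr1.
have colE j : bivariate_gf m j = g * h ^+ j by apply/fpsP => n; apply: mE.
rewrite mulrBr mulr1 mulrCA [_ * fpsC h]mulrC fpsDE fpsNE fpsXM fpsCE colE.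
case: k => [|k]; first by rewrite subr0 mulr1.
by rewrite fpsCM colE exprS mulrCA subrr.
Qed.

Theorem proposition4 :
  let t := num_paths in
  let z : {fps rat} := fpsX in
  let s := fps_sqrt (1 - 4 * z + 2 * z ^+ 2 - 4 * z ^+ 3 + z ^+ 4) in
  let f := (1 - z ^+ 2 - s) / 2 in
  (* the division by 2 z^3 (1 - z + z^2) takes place in the fraction field *)
  exists2 g : {fps rat},
    g%:F = (1 - 3 * z + z ^+ 2 - z ^+ 3 - (1 - z) * s)%:F
           / (2 * z ^+ 3 * (1 - z + z ^+ 2))%:F
  & is_rectification (fun n k => (t n.+1 k.+1)%:R) g f
    /\ [seq [seq t n.+1 k.+1 | k <- iota 0 5] | n <- iota 0 5] =
       [:: [::  1;   1;   1;   1;   1];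
           [::  3;   3;   3;   3;   3];
           [::  8;  10;  12;  14;  16];
           [:: 23;  33;  43;  53;  63];
           [:: 69; 107; 149; 195; 245]]%N.
Proof.
move=> t z s f.
have z0 : z 0%N = 0 by [].
have z_neq0 : z != 0 by apply/eqP => /fpsP/(_ 1%N).
have two_unit : (2 : {fps rat}) \is a GRing.unit.
  by rewrite fps_unitE fps_natrE.
have two_neq0 : (2 : {fps rat}) != 0.
  by apply: contraTneq two_unit => ->; rewrite unitr0.
have const0 : (1 - 4 * z + 2 * z ^+ 2 - 4 * z ^+ 3 + z ^+ 4) 0%N = 1.
  by rewrite !exprS expr0 !(fpsDE, fpsNE, fpsM0E, fps1E, fps_natrE) z0 /=; ring.
have sE : s = 1 - z ^+ 2 - 2 * f.
  by rewrite /f mulrC divrK //; ring.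
have s0 : s 0%N = 1 by [].
have s2 : s ^+ 2 = 1 - 4 * z + 2 * z ^+ 2 - 4 * z ^+ 3 + z ^+ 4.
  exact: sqr_fps_sqrt.
clearbody f; clearbody s.
have fE : f ^+ 2 = (1 - z ^+ 2) * f - (z - z ^+ 2 + z ^+ 3).
  (* Four times the claim is the equation s2 expressed in f. *)
  apply: (mulfI two_neq0); apply: (mulfI two_neq0).
  apply/eqP; rewrite -subr_eq0; apply/eqP.
  by move/eqP: s2; rewrite sE -subr_eq0 => /eqP <-; ring.
have f0 : f 0%N = 0.
  move: s0; rewrite sE !exprS expr0.
  by rewrite !(fpsDE, fpsNE, fpsM0E, fps1E, fps_natrE) z0 /=; lra.
pose h := fps_divX f; have fh : f = z * h by rewrite fps_divXK.
have hE : z * h ^+ 2 = (1 - z ^+ 2) * h - (1 - z + z ^+ 2).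
  apply: (mulfI z_neq0); transitivity (f ^+ 2); first by rewrite fh; ring.
  by rewrite fE fh; ring.
have h0 : h 0%N = 1.
  move/fpsP/(_ 0%N): hE; rewrite !exprS !expr0.
  by rewrite !(fpsDE, fpsNE, fpsM0E, fps1E, fps_natrE) z0 /=; lra.
pose D := 1 - 2 * z - (1 - z) * f.
have D0 : D 0%N = 1.
  by rewrite !(fpsDE, fpsNE, fpsM0E, fps1E, fps_natrE) z0 /= f0; ring.
have uD : D \is a GRing.unit by rewrite fps_unitE D0 unitr1.
have gD : D^-1 * D = 1 by rewrite mulVr.
set g := D^-1 in gD *; exists g.
  apply: (canRL (mulfK _)).
    rewrite tofrac_eq0 !mulf_neq0 ?expf_neq0 //.
    apply/eqP => /fpsP/(_ 0%N); rewrite !exprS expr0.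
    by rewrite !(fpsDE, fpsNE, fpsM0E, fps1E, fps_natrE) z0 /=; lra.
  rewrite -tofracM; congr tofrac; rewrite sE.
  (* Multiplying by D turns the claim into a polynomial identity in z and f,
     which holds modulo the quadratic equation. *)
  apply: (mulIr uD); rewrite mulrAC gD /D.
  by ring: fE.
split.
  rewrite fh; apply: rectificationP; rewrite ?h0 ?oner_neq0 //.
    move/fpsP/(_ 0%N): gD; rewrite fpsM0E D0 mulr1 fps1E => ->.
    exact: oner_neq0.
  move=> n k; rewrite /t num_pathsE; apply: path_gf_geometric => //.
  by rewrite -/z -fh.
rewrite /t; under eq_map do under eq_map do rewrite num_pathsE.
by vm_compute.
Qed.
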